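(* Let $F_t(z)=z-tH(z)\in\mathbb E_t^{[\alpha]}\langle\langle z\rangle\rangle$ with inverse map $G_t(z)=z+tN_t(z)$, $N_t(z)=\sum_{m\ge1}t^{m-1}N_{[m]}(z)$. For any $m\ge1$, $$N_{[m]}(z)=(-1)^m\sum_{I\in\mathcal C_m}(-1)^{\ell(I)}\,\lambda^Iz,$$ where, for $k\ge 1$, $\lambda_k=\frac1{k!}\big[H(w)\frac{\partial}{\partial z}\big]^k\big|_{w=z}$ in general, and $\lambda_k=\sum_{I\in\mathbb N^n,\,|I|=k}\frac1{I!}H^I(z)\frac{\partial^k}{\partial z^I}$ when $z$ are commutative variables.
   Context: $K$ is a unital commutative $\mathbb Q$-algebra, $z=(z_1,\dots,z_n)$ are commutative or noncommutative free variables, and $t$ is a formal parameter commuting with $z$ and $K$. $K\langle\langle z\rangle\rangle$ and $K[[t]]\langle\langle z\rangle\rangle$ are the formal power series algebras in $z$ (in either the commutative or the noncommutative case); $o(\cdot)$ is the order in $z$. For $\alpha\ge1$, $\mathbb E_t^{[\alpha]}\langle\langle z\rangle\rangle$ is the set of automorphisms of $K[[t]]\langle\langle z\rangle\rangle$ over $K[[t]]$ of the form $F_t(z)=z-tH(z)$ with $H(z)\in K\langle\langle z\rangle\rangle^{\times n}$, $o(H(z))\ge\alpha$. Its inverse map $G_t=F_t^{-1}$ is written $G_t(z)=z+tN_t(z)$, and $N_{[m]}(z)\in K\langle\langle z\rangle\rangle^{\times n}$ ($m\ge1$) are defined by $N_t(z)=\sum_{m\ge1}t^{m-1}N_{[m]}(z)$.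 For a vector $\vec u=(u_1,\dots,u_n)$ of power series, $[\vec u\frac{\partial}{\partial z}]$ is the derivation sending $z_i$ to $u_i$. The notation $[H(w)\frac{\partial}{\partial z}]^k|_{w=z}$ denotes the operator obtained as follows: $w=(w_1,\dots,w_n)$ are free variables independent of $z$; apply $k$ times the derivation sending $z_i\mapsto H_i(w)$ and $w_i\mapsto0$, then replace $w$ by $z$. Operators are applied to vectors componentwise, so $Pz=(Pz_1,\dots,Pz_n)$. For a multi-index $I=(i_1,\dots,i_n)\in\mathbb N^n$ ($0\in\mathbb N$): $|I|=\sum i_j$, $I!=\prod i_j!$, $H^I=\prod H_j^{i_j}$, $\partial z^I=\partial z_1^{i_1}\cdots\partial z_n^{i_n}$. A composition is a nonempty finite sequence $I=(i_1,\dots,i_k)$ of positive integers; $\ell(I)=k$, $|I|=i_1+\cdots+i_k$; $\mathcal C_m$ is the set of compositions with $|I|=m$; $\lambda^I=\lambda_{i_1}\cdots\lambda_{i_k}$ (composition of operators). *)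

(* Defs.v *)
From HB Require Import structures.
From mathcomp Require Import all_boot all_order all_algebra.
From mathcomp Require Import boolp.

Set Implicit Arguments.
Unset Strict Implicit.
Unset Printing Implicit Defensive.

Import GRing.Theory.
Local Open Scope ring_scope.

(* A monoid of monomials: graded, with finitely many elements in each degree. *)
HB.mixin Record isGradedMonoid M of Monoid M := {
  mdeg : M -> nat;
  mdeg1 : mdeg 1%g = 0%N;
  mdegM : forall a b : M, mdeg (a * b)%g = (mdeg a + mdeg b)%N;
  mlevel : nat -> seq M;
  mlevel_uniq : forall d, uniq (mlevel d);
  mem_mlevel : forall d m, (m \in mlevel d) = (mdeg m == d)
}.

#[short(type="gradedMonoidType")]
HB.structure Definition GradedMonoid := {M of isGradedMonoid M & Monoid M}.

Section Ball.
Variable M : gradedMonoidType.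

(* the monomials of degree at most d *)
Definition mball d : seq M := flatten [seq mlevel k | k <- iota 0 d.+1].

Lemma mem_mball d m : (m \in mball d) = (mdeg m <= d)%N.
Proof.
apply/flatten_mapP/idP => [[k]|le_md].
  by rewrite mem_iota mem_mlevel => /= + /eqP->.
by exists (mdeg m); rewrite ?mem_mlevel // mem_iota.
Qed.

Lemma mball_uniq d : uniq (mball d).
Proof.
rewrite /mball; elim: d.+1 0%N => //= k IHk j; rewrite cat_uniq mlevel_uniq IHk.
rewrite andbT; apply/hasPn => m /flatten_mapP[i]; rewrite mem_iota mem_mlevel.
move=> /andP[lt_ji _] /eqP dm; rewrite mem_mlevel dm.
by rewrite neq_ltn lt_ji orbT.
Qed.

End Ball.

(* Formal power series: arbitrary families of coefficients. *)
Definition series (M : gradedMonoidType) (R : Type) : Type := M -> R.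

HB.instance Definition _ M R := gen_eqMixin (series M R).
HB.instance Definition _ M R := gen_choiceMixin (series M R).

Section SeriesRing.
Variables (M : gradedMonoidType) (R : pzRingType).
Implicit Types (f g h : series M R) (a b m : M) (k l : R).

Lemma seriesP f g : (forall m, f m = g m) -> f = g.
Proof. exact: funext. Qed.

Definition series0 : series M R := fun=> 0.
Definition seriesN f : series M R := fun m => - f m.
Definition seriesD f g : series M R := fun m => f m + g m.

Fact seriesDA : associative seriesD.
Proof. by move=> f g h; apply: seriesP => m; apply: addrA. Qed.
Fact seriesDC : commutative seriesD.
Proof. by move=> f g; apply: seriesP => m; apply: addrC. Qed.
Fact series0D : left_id series0 seriesD.
Proof. by move=> f; apply: seriesP => m; apply: add0r. Qed.
Fact seriesND : left_inverse series0 seriesN seriesD.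
Proof. by move=> f; apply: seriesP => m; apply: addNr. Qed.

HB.instance Definition _ :=
  GRing.isZmodule.Build (series M R) seriesDA seriesDC series0D seriesND.

Lemma series0E m : (0 : series M R) m = 0. Proof. by []. Qed.
Lemma seriesDE f g m : (f + g) m = f m + g m. Proof. by []. Qed.
Lemma seriesNE f m : (- f) m = - f m. Proof. by []. Qed.

Definition series1 : series M R := fun m => (m == 1%g)%:R.
Definition seriesM f g : series M R := fun m =>
  \sum_(a <- mball M (mdeg m)) \sum_(b <- mball M (mdeg m) | (a * b)%g == m)
     f a * g b.

Lemma sum_pred1 (s : seq M) (F : M -> R) x : uniq s -> x \in s ->
  \sum_(i <- s | i == x) F i = F x.
Proof.
by move=> s_uniq sx; rewrite -big_filter filter_pred1_uniq // big_seq1.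
Qed.

Lemma sum_mball d e (F : M -> R) : (e <= d)%N ->
    (forall m, (e < mdeg m)%N -> F m = 0) ->
  \sum_(m <- mball M d) F m = \sum_(m <- mball M e) F m.
Proof.
move=> le_ed F0; rewrite [LHS](bigID (fun m => (mdeg m <= e)%N)) /=.
rewrite [X in _ + X]big1 ?addr0 => [|m]; last by rewrite -ltnNge => /F0.
rewrite -big_filter; apply/perm_big/uniq_perm; rewrite ?filter_uniq ?mball_uniq //.
move=> m; rewrite mem_filter !mem_mball andb_idr // => le_me.
exact: leq_trans le_me le_ed.
Qed.

Lemma seriesM_ball f g m d : (mdeg m <= d)%N ->
  seriesM f g m =
  \sum_(a <- mball M d) \sum_(b <- mball M d | (a * b)%g == m) f a * g b.
Proof.
move=> le_md; rewrite [RHS](@sum_mball _ (mdeg m)) // => [|a lt_ma].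
  apply: eq_bigr => a _; rewrite big_mkcond [RHS]big_mkcond /=.
  apply/esym/sum_mball => // b lt_mb; case: eqP => // E.
  by move: lt_mb; rewrite -E mdegM ltnNge leq_addl.
rewrite big1 // => b /eqP E.
by move: lt_ma; rewrite -E mdegM ltnNge leq_addr.
Qed.

Fact seriesMA : associative seriesM.
Proof.
move=> f g h; apply: seriesP => m.
set B := mball M (mdeg m).
have le_deg a b : (a * b)%g = m -> (mdeg a <= mdeg m)%N /\ (mdeg b <= mdeg m)%N.
  by move=> <-; rewrite mdegM leq_addr leq_addl.
transitivity (\sum_(a <- B) \sum_(b <- B) \sum_(c <- B | (a * b * c)%g == m)
                f a * g b * h c); last first.
  rewrite /seriesM -/B.
  transitivity (\sum_(x <- B) \sum_(c <- B | (x * c)%g == m)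
     \sum_(a <- B) \sum_(b <- B | (a * b)%g == x) f a * g b * h c); last first.
    rewrite big_seq [RHS]big_seq; apply: eq_bigr => x; rewrite mem_mball => Bx.
    apply: eq_bigr => c _; rewrite -/(seriesM f g x) (seriesM_ball f g Bx).
    by rewrite mulr_suml; apply: eq_bigr => a _; rewrite mulr_suml.
  under [RHS]eq_bigr do rewrite exchange_big.
  rewrite [RHS]exchange_big; apply: eq_bigr => a _ /=.
  under [RHS]eq_bigr do rewrite exchange_big big_mkcond.
  rewrite [RHS]exchange_big; apply: eq_bigr => b _ /=.
  rewrite -big_mkcond; have [Bab|Bab] := boolP ((a * b)%g \in B).
    rewrite [RHS](eq_bigl (fun x => x == (a * b)%g)) => [|x]; last exact: eq_sym.
    by rewrite sum_pred1 ?mball_uniq.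
  rewrite [LHS]big1 => [|x /eqP E]; last first.
    by have [] := le_deg _ _ E; rewrite -mem_mball (negPf Bab).
  rewrite big_seq_cond big1 // => x /andP[Bx /eqP abx].
  by rewrite abx Bx in Bab.
rewrite /seriesM -/B; apply: eq_bigr => a _.
transitivity (\sum_(x <- B | (a * x)%g == m)
     \sum_(b <- B) \sum_(c <- B | (b * c)%g == x) f a * g b * h c).
  rewrite big_seq_cond [RHS]big_seq_cond; apply: eq_bigr => x.
  rewrite mem_mball => /andP[Bx _].
  rewrite -/(seriesM g h x) (seriesM_ball g h Bx) mulr_sumr; apply: eq_bigr => b _.
  by rewrite mulr_sumr; apply: eq_bigr => c _; rewrite mulrA.
rewrite exchange_big; apply: eq_bigr => b _ /=.
under eq_bigr do rewrite big_mkcond.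
rewrite exchange_big [RHS]big_mkcond; apply: eq_bigr => c _ /=.
rewrite big_mkcond (bigID (fun x => x == (b * c)%g)) /= [X in _ + X]big1 ?addr0; last first.
  by move=> x; rewrite eq_sym => /negPf->; case: ifP.
have [Bbc|Bbc] := boolP ((b * c)%g \in B).
  by rewrite sum_pred1 ?mball_uniq // eqxx mulgA.
rewrite big_seq_cond big1 => [|x /andP[Bx /eqP E]]; last by rewrite -E Bx in Bbc.
case: eqP => // E; rewrite mem_mball in Bbc.
by have [_] := le_deg _ _ (etrans (mulgA a b c) E); rewrite (negPf Bbc).
Qed.

Fact series1M : left_id series1 seriesM.
Proof.
move=> f; apply: seriesP => m; rewrite /seriesM.
transitivity (\sum_(a <- mball M (mdeg m) | a == 1%g) f m).
  rewrite [RHS]big_mkcond; apply: eq_bigr => a _; rewrite /series1.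
  case: eqP => [->|_]; last by rewrite big1 // => b _; rewrite mul0r.
  under eq_bigl do rewrite mul1g.
  by rewrite sum_pred1 ?mball_uniq ?mem_mball ?mul1r.
by rewrite (sum_pred1 (fun=> _)) ?mball_uniq ?mem_mball ?mdeg1.
Qed.

Fact seriesM1 : right_id series1 seriesM.
Proof.
move=> f; apply: seriesP => m; rewrite /seriesM.
transitivity (\sum_(a <- mball M (mdeg m) | a == m) f a).
  rewrite [RHS]big_mkcond; apply: eq_bigr => a _; rewrite /series1.
  transitivity (\sum_(b <- mball M (mdeg m) | b == 1%g) if a == m then f a else 0).
    rewrite [LHS]big_mkcond [RHS]big_mkcond; apply: eq_bigr => b _.
    case: (b =P 1%g) => [->|_]; first by rewrite mulg1 mulr1.
    by rewrite mulr0; case: ifP.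
  by rewrite (sum_pred1 (fun=> _)) ?mball_uniq ?mem_mball ?mdeg1.
by rewrite sum_pred1 ?mball_uniq ?mem_mball.
Qed.

Fact seriesMDl : left_distributive seriesM +%R.
Proof.
move=> f g h; apply: seriesP => m; rewrite seriesDE -big_split.
apply: eq_bigr => a _ /=; rewrite -big_split.
by apply: eq_bigr => b _; apply: mulrDl.
Qed.

Fact seriesMDr : right_distributive seriesM +%R.
Proof.
move=> f g h; apply: seriesP => m; rewrite seriesDE -big_split.
apply: eq_bigr => a _ /=; rewrite -big_split.
by apply: eq_bigr => b _; apply: mulrDr.
Qed.

HB.instance Definition _ := GRing.Zmodule_isPzRing.Build (series M R)
  seriesMA series1M seriesM1 seriesMDl seriesMDr.

Lemma series1E m : (1 : series M R) m = (m == 1%g)%:R. Proof. by []. Qed.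

Definition seriesZ k f : series M R := fun m => k * f m.

Fact seriesZA k l f : seriesZ k (seriesZ l f) = seriesZ (k * l) f.
Proof. by apply: seriesP => m; apply: mulrA. Qed.
Fact series1Z : left_id 1 seriesZ.
Proof. by move=> f; apply: seriesP => m; apply: mul1r. Qed.
Fact seriesZDr : right_distributive seriesZ +%R.
Proof. by move=> k f g; apply: seriesP => m; apply: mulrDr. Qed.
Fact seriesZDl f : {morph seriesZ^~ f : k l / k + l}.
Proof. by move=> k l; apply: seriesP => m; apply: mulrDl. Qed.

HB.instance Definition _ := GRing.Zmodule_isLmodule.Build R (series M R)
  seriesZA series1Z seriesZDr seriesZDl.

Lemma seriesZE k f m : (k *: f) m = k * f m. Proof. by []. Qed.

(* o(f) >= d *)
Definition order_ge (d : nat) f := forall m, (mdeg m < d)%N -> f m = 0.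

End SeriesRing.

(* R[[t]] is series tpow R: the exponent j stands for the monomial t^j. *)
Definition tpow : Type := nat.
HB.instance Definition _ := Choice.on tpow.
HB.instance Definition _ := isMonoid.Build tpow addnA add0n addn0.

Section TPow.
Fact tpow_deg1 : id (1%g : tpow) = 0%N :> nat. Proof. by []. Qed.
Fact tpow_degM (a b : tpow) : id (a * b)%g = (a + b)%N :> nat. Proof. by []. Qed.
Fact tpow_uniq d : uniq [:: d : tpow]. Proof. by []. Qed.
Fact tpow_mem d (m : tpow) : (m \in [:: d : tpow]) = ((m : nat) == d).
Proof. by rewrite inE. Qed.
HB.instance Definition _ :=
  isGradedMonoid.Build tpow tpow_deg1 tpow_degM tpow_uniq tpow_mem.
End TPow.

(* Monomials in noncommutative free variables indexed by X. *)
Definition ncmon (X : finType) : Type := seq X.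
HB.instance Definition _ X := Choice.on (ncmon X).
HB.instance Definition _ X :=
  isMonoid.Build (ncmon X) (@catA X) (@cat0s X) (@cats0 X).

Section NCMon.
Variable X : finType.
Definition nclevel d : seq (ncmon X) := [seq val t | t <- enum {: d.-tuple X}].
Fact ncmon_deg1 : size (1%g : ncmon X) = 0%N. Proof. by []. Qed.
Fact ncmon_degM (a b : ncmon X) : size (a * b)%g = (size a + size b)%N.
Proof. exact: size_cat. Qed.
Fact nclevel_uniq d : uniq (nclevel d).
Proof. by rewrite map_inj_uniq ?enum_uniq //; apply: val_inj. Qed.
Fact mem_nclevel d (m : ncmon X) : (m \in nclevel d) = (size m == d).
Proof.
apply/mapP/idP => [[t _ ->]|sz_m]; first by rewrite size_tuple.
by exists (Tuple sz_m); rewrite ?mem_enum.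
Qed.
HB.instance Definition _ :=
  isGradedMonoid.Build (ncmon X) ncmon_deg1 ncmon_degM nclevel_uniq mem_nclevel.
End NCMon.

(* Monomials in commutative variables indexed by X: exponent vectors. *)
Definition cmon (X : finType) : Type := {ffun X -> nat}.
HB.instance Definition _ X := Choice.on (cmon X).

Section CMon.
Variable X : finType.
Implicit Types a b m : cmon X.
Definition cmon1 : cmon X := [ffun=> 0%N].
Definition cmonM a b : cmon X := [ffun x => (a x + b x)%N].
Fact cmonMA : associative cmonM.
Proof. by move=> a b c; apply/ffunP => x; rewrite !ffunE addnA. Qed.
Fact cmon1M : left_id cmon1 cmonM.
Proof. by move=> a; apply/ffunP => x; rewrite !ffunE add0n. Qed.
Fact cmonM1 : right_id cmon1 cmonM.
Proof. by move=> a; apply/ffunP => x; rewrite !ffunE addn0. Qed.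
HB.instance Definition _ := isMonoid.Build (cmon X) cmonMA cmon1M cmonM1.

Definition cdeg m : nat := (\sum_x m x)%N.
Definition clevel d : seq (cmon X) :=
  [seq [ffun x => val (f x)] | f : {ffun X -> 'I_d.+1} <- enum {: {ffun X -> 'I_d.+1}}
                             & (\sum_x val (f x))%N == d].
Fact cmon_deg1 : cdeg 1%g = 0%N.
Proof. by rewrite /cdeg big1 // => x _; rewrite ffunE. Qed.
Fact cmon_degM a b : cdeg (a * b)%g = (cdeg a + cdeg b)%N.
Proof. by rewrite /cdeg -big_split; apply: eq_bigr => x _; rewrite ffunE. Qed.
Fact clevel_uniq d : uniq (clevel d).
Proof.
rewrite map_inj_uniq => [|f g]; first exact/filter_uniq/enum_uniq.
move=> /ffunP E.
by apply/ffunP => x; apply: val_inj; have := E x; rewrite !ffunE.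
Qed.
Fact mem_clevel d m : (m \in clevel d) = (cdeg m == d).
Proof.
apply/mapP/idP => [[f]|/eqP deg_m].
  rewrite mem_filter => /andP[/eqP sf _] ->; apply/eqP; rewrite -[RHS]sf.
  by apply: eq_bigr => x _; rewrite ffunE.
have lt_m x : (m x < d.+1)%N by rewrite ltnS -deg_m /cdeg (bigD1 x) //= leq_addr.
exists [ffun x => Ordinal (lt_m x)]; last by apply/ffunP => x; rewrite !ffunE.
rewrite mem_filter mem_enum andbT -[X in _ == X]deg_m; apply/eqP.
by apply: eq_bigr => x _; rewrite ffunE.
Qed.
HB.instance Definition _ :=
  isGradedMonoid.Build (cmon X) cmon_deg1 cmon_degM clevel_uniq mem_clevel.
End CMon.

Variant varkind := Commutative | Noncommutative.

Definition monom (c : varkind) (X : finType) : gradedMonoidType :=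
  match c with Commutative => cmon X | Noncommutative => ncmon X end.

Definition mvar (c : varkind) (X : finType) (x : X) : monom c X :=
  match c with
  | Commutative => [ffun y => (y == x : nat)]
  | Noncommutative => [:: x]
  end.

(* The variables of a monomial, with multiplicity and in order; a commutative
   monomial is written as x_1 ... x_1 x_2 ... x_2 ... along enum X. *)
Definition mword (c : varkind) (X : finType) : monom c X -> seq X :=
  match c with
  | Commutative => fun m => flatten [seq nseq (m x) x | x <- enum X]
  | Noncommutative => fun m => m
  end.

(* R<<X>>, with commuting or free noncommuting variables according to c. *)
Notation pseries c X R := (series (monom c X) R).

Section PowerSeries.
Variables (c : varkind) (R : pzRingType).

Definition zvar (X : finType) (x : X) : pseries c X R :=
  fun m => (m == mvar c x)%:R.

(* Only the monomials m with mdeg m <= mdeg v can contribute to the coefficient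
   at v of f(F), provided the components of F have order at least 1; subst is
   used for such F only. *)
Definition subst (X Y : finType) (F : X -> pseries c Y R) (f : pseries c X R) :
    pseries c Y R :=
  fun v => \sum_(m <- mball (monom c X) (mdeg v))
             f m * (\prod_(x <- mword m) F x) v.

Section Derivation.
Variables (X : finType) (u : X -> pseries c X R).

(* Leibniz rule: the value of the derivation on the monomial with word w. *)
Fixpoint zderiv_word (w : seq X) : pseries c X R :=
  if w is x :: w' then
    u x * \prod_(y <- w') zvar y + zvar x * zderiv_word w'
  else 0.

(* [u d/dz], the continuous derivation sending z_x to u x: since it lowers the
   degree by at most 1, only the monomials of degree at most mdeg v + 1 can
   contribute to the coefficient at v. *)
Definition zderiv (f : pseries c X R) : pseries c X R :=
  fun v => \sum_(m <- mball (monom c X) (mdeg v).+1)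
             f m * zderiv_word (mword m) v.

End Derivation.

Definition partial (X : finType) (j : X) : pseries c X R -> pseries c X R :=
  zderiv (fun x => (x == j)%:R).

(* d^|I| / dz^I *)
Definition partialI (X : finType) (I : X -> nat) (f : pseries c X R) :=
  foldr (fun j => iter (I j) (partial j)) f (enum X).

(* The substitution f |-> f(F) is an automorphism of R<<z>> over R; it is
   automatically an R-algebra morphism as F has no constant term. *)
Definition automorphism (n : nat) (F : 'I_n -> pseries c 'I_n R) :=
  (forall i, order_ge 1 (F i)) /\ bijective (subst F).

(* F(G(z)) = z = G(F(z)) *)
Definition inverse_map (n : nat) (F G : 'I_n -> pseries c 'I_n R) :=
  [/\ forall i, order_ge 1 (G i),
      forall i, subst G (F i) = zvar i &
      forall i, subst F (G i) = zvar i].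

End PowerSeries.

Arguments zvar {c R X} x.

Section TParam.
Variables (c : varkind) (K : pzRingType).

Definition tparam : series tpow K := fun j => ((j : nat) == 1%N)%:R.

(* K<<z>> -> K[[t]]<<z>> *)
Definition constt (X : finType) (f : pseries c X K) :
    pseries c X (series tpow K) :=
  fun m => f m *: (1 : series tpow K).

(* \sum_(j >= 0) t^j a_j *)
Definition tsum (X : finType) (a : nat -> pseries c X K) :
    pseries c X (series tpow K) :=
  fun m j => a j m.

(* F_t is the element z - t H(z) of E_t^[alpha]. *)
Definition in_Et (alpha n : nat) (H : 'I_n -> pseries c 'I_n K)
    (F : 'I_n -> pseries c 'I_n (series tpow K)) :=
  [/\ forall i, order_ge alpha (H i),
      forall i, F i = zvar i - tparam *: constt (H i) &
      automorphism F].

End TParam.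

Section Operators.
Variables (c : varkind) (K : comAlgType rat) (n : nat).
Variable H : 'I_n -> pseries c 'I_n K.

(* The variables (z, w) are indexed by 'I_n + 'I_n: inl i is z_i, inr i is w_i. *)
Definition zw_derivation : pseries c ('I_n + 'I_n)%type K ->
    pseries c ('I_n + 'I_n)%type K :=
  zderiv (fun x => match x with
                  | inl i => subst (fun j => zvar (inr j)) (H i)
                  | inr _ => 0
                  end).

(* k!^-1 [H(w) d/dz]^k |_(w = z) *)
Definition lambda (k : nat) (f : pseries c 'I_n K) : pseries c 'I_n K :=
  (k`!%:R^-1 : rat)%:A *:
  subst (fun x => match x with inl i => zvar i | inr i => zvar i end)
    (iter k zw_derivation (subst (fun j => zvar (inl j)) f)).

(* \sum_(|I| = k) 1/I! H^I d^k/dz^I; meant for commutative variables *)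
Definition lambda_comm (k : nat) (f : pseries c 'I_n K) : pseries c 'I_n K :=
  \sum_(I : {ffun 'I_n -> 'I_k.+1} | (\sum_j I j)%N == k)
    ((\prod_j (I j)`!)%N%:R^-1 : rat)%:A *:
    (\prod_j H j ^+ I j * partialI (fun j => I j : nat) f).

End Operators.

Definition compositions (m : nat) : seq (seq nat) :=
  [seq I <- flatten [seq [seq map val (val t) | t <- enum {: k.-tuple 'I_m.+1}]
                    | k <- iota 1 m]
   | all (leq 1) I & sumn I == m].

Lemma mem_compositions m I :
  (I \in compositions m) = [&& I != [::], all (leq 1) I & sumn I == m].
Proof.
rewrite mem_filter [LHS]andbC; apply/andP/and3P => [[]|[I0 I1 sI]].
  case/flatten_mapP => k; rewrite mem_iota => /andP[k1 _] /mapP[t _ ->].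
  case/andP=> -> ->; split=> //; apply: contraTneq k1 => t0.
  by rewrite -(size_tuple t) -(size_map val) t0.
split; last by rewrite I1.
have szI : (size I <= m)%N.
  rewrite -(eqP sI) -sum1_size sumnE big_seq [leqRHS]big_seq.
  by apply: leq_sum => i /(allP I1).
have leI : all (fun i => i <= m)%N I.
  apply/allP => i iI; rewrite -(eqP sI) sumnE (big_rem i) //= leq_addr //.
apply/flatten_mapP; exists (size I).
  by rewrite mem_iota add1n ltnS szI andbT lt0n size_eq0.
have szt : size (map inord I : seq 'I_m.+1) == size I by rewrite size_map.
apply/mapP; exists (Tuple szt); rewrite ?mem_enum //= -map_comp.
rewrite -[LHS]map_id; apply/eq_in_map => i iI /=.
by rewrite inordK // ltnS (allP leI).
Qed.

Lemma compositions_uniq m : uniq (compositions m).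
Proof.
apply/filter_uniq; have := iota_uniq 1 m.
elim: (iota 1 m) => //= k r IHr /andP[r'k r_uniq].
rewrite cat_uniq IHr // andbT map_inj_uniq ?enum_uniq; last first.
  by move=> s t /(inj_map val_inj)/val_inj.
apply/hasPn => I /flatten_mapP[i r_i] /mapP[t _ ->].
apply/mapP => -[s _ /(congr1 size)]; rewrite !size_map !size_tuple => E.
by rewrite -E r_i in r'k.
Qed.

(* lambda^I, the composite operator lambda_(i_1) ... lambda_(i_k) *)
Definition op_comp (T : Type) (L : nat -> T -> T) (I : seq nat) (f : T) : T :=
  foldr L f I.

(* Main.v *)
Require Import Defs.
From HB Require Import structures.
From mathcomp Require Import all_boot all_order all_algebra.
From mathcomp Require Import boolp.

Set Implicit Arguments.
Unset Strict Implicit.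
Unset Printing Implicit Defensive.

Import GRing.Theory.
Local Open Scope ring_scope.

(** The formula is the solution of a recursion that comes from Taylor's formula.

Write N_[0](z) = z, so that G_t = sum_(a >= 0) t^a N_[a].  Substituting
z - t H(z) for z in a series f over K gives Taylor's formula
f(z - t H) = sum_k (-t)^k (lambda_k f)(z), with lambda_0 the identity.
Applied to each N_[a], it turns G_t(F_t(z)) = z into
  sum_(a <= p) (-1)^(p - a) lambda_(p - a) N_[a] = 0   for every p >= 1.
Solving for N_[p] and unfolding the recursion, each chain of indices
0 < ... < a < p contributes the composition of p formed by its successive
differences; this is [sum_over_compositions].

Taylor's formula is checked on monomials.  All the operators involved are
continuous for the adic topology and linear, hence determined by their values
on products of variables ([eq_continuous_words]).  On the product of a word w,
the coefficient of s^k in the product of the z_x + s H_x, x in w, is the sum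
[mixed zvar H w k] over all the ways to replace k letters x by H_x, and the
three operators are compared with it:
- substituting z - t H: the coefficient of t^k is (-1)^k times that sum
  ([tcoef_prod]);
- [H(w) d/dz]^k / k!: the derivation kills the auxiliary copy of the variables
  in which H is taken, so each application replaces one more letter z_x by H_x,
  and each choice of k letters is reached in k! orders ([zw_derivation_mixed], [lambda_word]);
- the sum of the H^I / I! d^k/dz^I: by Leibniz's rule this family of operators
  satisfies the recursion in w that defines the sum ([lambda_comm_zvarM]). *)

(** * Coefficients and order of a series *)

Section Order.
Variables (M : gradedMonoidType) (R : pzRingType).
Implicit Types (f g : series M R) (v m : M).

Lemma seriesME f g v : (f * g) v =
  \sum_(a <- mball M (mdeg v)) \sum_(b <- mball M (mdeg v) | (a * b)%g == v)
     f a * g b.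
Proof. by []. Qed.

Lemma series_sumE I (r : seq I) (P : pred I) (E : I -> series M R) v :
  (\sum_(i <- r | P i) E i) v = \sum_(i <- r | P i) E i v.
Proof. exact: (big_morph (fun f : series M R => f v)). Qed.

Lemma order_ge_mul p q f g :
  order_ge p f -> order_ge q g -> order_ge (p + q) (f * g).
Proof.
move=> fp gq v lt_v; rewrite seriesME big1 // => a _; rewrite big1 // => b /eqP E.
have [/fp->|le_pa] := ltnP (mdeg a) p; first by rewrite mul0r.
have [/gq->|le_qb] := ltnP (mdeg b) q; first by rewrite mulr0.
by move: lt_v; rewrite -E mdegM ltnNge leq_add.
Qed.

Lemma order_geD p f g : order_ge p f -> order_ge p g -> order_ge p (f + g).
Proof. by move=> fp gp v lt_v; rewrite seriesDE fp ?gp ?addr0. Qed.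

Lemma order_geW p q f : (q <= p)%N -> order_ge p f -> order_ge q f.
Proof. by move=> le_qp fp v lt_v; apply/fp/(leq_trans lt_v). Qed.

Lemma order_ge_prod X (F : X -> series M R) (w : seq X) :
  (forall x, order_ge 1 (F x)) -> order_ge (size w) (\prod_(x <- w) F x).
Proof.
move=> F1; elim: w => [|x w IHw]; first by rewrite big_nil => v.
by rewrite big_cons; apply: (order_ge_mul (F1 x)).
Qed.

End Order.

Section Monomials.
Variables (M : gradedMonoidType) (R : pzRingType).

Definition mono (m : M) : series M R := fun v => (v == m)%:R.

Lemma sum_mono d m (A : M -> R) : (mdeg m <= d)%N ->
  \sum_(a <- mball M d) mono m a * A a = A m.
Proof.
move=> le_md; rewrite -[RHS](@sum_pred1 M R (mball M d) A m) ?mball_uniq ?mem_mball //.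
rewrite [RHS]big_mkcond; apply: eq_bigr => a _; rewrite /mono.
by case: eqP => _; rewrite ?mul1r ?mul0r.
Qed.

Lemma sum_mono0 d m (A : M -> R) : (d < mdeg m)%N ->
  \sum_(a <- mball M d) mono m a * A a = 0.
Proof.
move=> lt_dm; rewrite big_seq big1 // => a; rewrite mem_mball /mono.
case: eqP => [->|_ _]; last by rewrite mul0r.
by rewrite leqNgt lt_dm.
Qed.

Lemma monoM a b : mono a * mono b = mono (a * b)%g.
Proof.
apply: seriesP => v; rewrite seriesME.
transitivity (\sum_(c <- mball M (mdeg v)) mono a c *
   \sum_(d <- mball M (mdeg v)) mono b d * ((c * d)%g == v)%:R).
  apply: eq_bigr => c _; rewrite mulr_sumr big_mkcond; apply: eq_bigr => d _.
  by case: eqP => _; rewrite ?mulr1 // mulr0 mulr0.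
have [le_ab|lt_ab] := boolP ((mdeg a <= mdeg v) && (mdeg b <= mdeg v))%N.
  case/andP: le_ab => le_a le_b; rewrite sum_mono // sum_mono //.
  by rewrite /mono eq_sym.
have -> : mono (a * b)%g v = 0.
  rewrite /mono; case: eqP => // E.
  by rewrite E mdegM leq_addr leq_addl in lt_ab.
move: lt_ab; rewrite negb_and -!ltnNge => /orP[lt_a|lt_b].
  by rewrite sum_mono0.
by rewrite big1 // => c _; rewrite sum_mono0 ?mulr0.
Qed.

End Monomials.
Arguments mono {M R} m.

(** * Continuous linear operators on series *)

Section Continuity.
Variable R : pzRingType.

(** Linear maps for which the coefficient of the image at v depends only on the
coefficients of degree at most mdeg v + d, with the same d for all v.  The
uniform shift is what makes this class closed under composition, and it
covers substitutions (d = 0) and derivations (d = 1). *)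
Definition continuous (M M' : gradedMonoidType) (L : series M R -> series M' R) :=
  exists d, forall f v,
    L f v = \sum_(m <- mball M (mdeg v + d)) f m * L (mono m) v.

Section OneOperator.
Variables (M M' : gradedMonoidType).
Implicit Types (L : series M R -> series M' R).

(** The shift may be enlarged, so that several operators can be expanded over
one and the same ball: a monomial m beyond the degree mdeg v + d contributes
nothing, as the expansion of L (mono m) at v shows. *)
Lemma continuous_widen L : continuous L -> exists d, forall e f v,
    (mdeg v + d <= e)%N ->
  L f v = \sum_(m <- mball M e) f m * L (mono m) v.
Proof.
case=> d Ld; exists d => e f v le_e; rewrite Ld; apply/esym/sum_mball => // m lt_m.
by rewrite Ld sum_mono0 ?mulr0.
Qed.

Lemma eq_continuous L L' : continuous L -> continuous L' ->
  (forall m, L (mono m) = L' (mono m)) -> L =1 L'.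
Proof.
move=> /continuous_widen[d Ld] /continuous_widen[d' Ld'] eqL f.
apply: seriesP => v; set e := (mdeg v + (d + d'))%N.
rewrite (Ld e) ?leq_add2l ?leq_addr // (Ld' e) ?leq_add2l ?leq_addl //.
by apply: eq_bigr => m _; rewrite eqL.
Qed.

(** The form in which substitutions and derivations are given: a family A of
prospective values on monomials, summed over a ball that contains the support
of each of its coefficients. *)
Lemma continuous_kernel L d (A : M -> series M' R) :
    (forall m v, (mdeg v + d < mdeg m)%N -> A m v = 0) ->
    (forall f v, L f v = \sum_(m <- mball M (mdeg v + d)) f m * A m v) ->
  continuous L /\ forall m, L (mono m) = A m.
Proof.
move=> A0 LE; have LA m : L (mono m) = A m.
  apply: seriesP => v; rewrite LE.
  have [le_m|lt_m] := leqP (mdeg m) (mdeg v + d); first by rewrite sum_mono.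
  by rewrite sum_mono0 // A0.
by split=> //; exists d => f v; rewrite LE; apply: eq_bigr => m _; rewrite LA.
Qed.

Lemma continuousD L f g : continuous L -> L (f + g) = L f + L g.
Proof.
case=> d Ld; apply: seriesP => v; rewrite seriesDE !Ld -big_split.
by apply: eq_bigr => m _; rewrite seriesDE mulrDl.
Qed.

Lemma continuousZ L k f : continuous L -> L (k *: f) = k *: L f.
Proof.
case=> d Ld; apply: seriesP => v; rewrite seriesZE !Ld mulr_sumr.
by apply: eq_bigr => m _; rewrite mulrA.
Qed.

Lemma continuous0 L : continuous L -> L 0 = 0.
Proof.
by move=> /(@continuousZ _ 0 0); rewrite !scale0r.
Qed.

Lemma continuousMn L f k : continuous L -> L (f *+ k) = L f *+ k.
Proof.
move=> Lc; elim: k => [|k IHk]; first exact: continuous0.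
by rewrite !mulrS continuousD // IHk.
Qed.

Lemma continuous_sum L I (r : seq I) (P : pred I) (E : I -> series M R) :
  continuous L -> L (\sum_(i <- r | P i) E i) = \sum_(i <- r | P i) L (E i).
Proof.
by move=> Lc; apply: (big_morph L (fun f g => continuousD f g Lc) (continuous0 Lc)).
Qed.

Lemma continuous_add L L' : continuous L -> continuous L' ->
  continuous (fun f => L f + L' f).
Proof.
move=> /continuous_widen[d Ld] /continuous_widen[d' Ld'].
exists (d + d')%N => f v.
rewrite seriesDE (Ld (mdeg v + (d + d'))%N) ?leq_add2l ?leq_addr //.
rewrite (Ld' (mdeg v + (d + d'))%N) ?leq_add2l ?leq_addl // -big_split.
by apply: eq_bigr => m _; rewrite seriesDE mulrDr.
Qed.

Lemma continuous_zero : continuous (fun _ : series M R => 0 : series M' R).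
Proof. by exists 0%N => f v; rewrite big1 // => m _; rewrite mulr0. Qed.

Lemma continuous_bigsum I (r : seq I) (P : pred I)
    (L : I -> series M R -> series M' R) :
  (forall i, continuous (L i)) -> continuous (fun f => \sum_(i <- r | P i) L i f).
Proof.
move=> Lc; elim: r => [|i r IHr].
  by under [X in continuous X]eq_fun do rewrite big_nil; apply: continuous_zero.
under [X in continuous X]eq_fun do rewrite big_cons.
by case: (P i) => //; apply: continuous_add.
Qed.

End OneOperator.

Lemma continuous_id M : continuous (@id (series M R)).
Proof.
exists 0%N => f v; transitivity (\sum_(m <- mball M (mdeg v) | m == v) f m).
  by rewrite sum_pred1 ?mball_uniq ?mem_mball.
rewrite addn0 big_mkcond; apply: eq_bigr => m _ /=; rewrite /mono eq_sym.
by case: eqP => _; rewrite ?mulr1 ?mulr0.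
Qed.

Lemma continuous_comp M M' M'' (L : series M R -> series M' R)
    (L' : series M' R -> series M'' R) :
  continuous L -> continuous L' -> continuous (L' \o L).
Proof.
move=> /continuous_widen[d Ld] [d' Ld']; exists (d' + d)%N => f v /=.
rewrite Ld'; transitivity (\sum_(u <- mball M' (mdeg v + d'))
    \sum_(m <- mball M (mdeg v + (d' + d))) f m * L (mono m) u * L' (mono u) v).
  rewrite big_seq [RHS]big_seq; apply: eq_bigr => u; rewrite mem_mball => le_u.
  by rewrite (Ld (mdeg v + (d' + d))%N) ?addnA ?leq_add2r // mulr_suml.
rewrite exchange_big; apply: eq_bigr => m _ /=.
by rewrite Ld' mulr_sumr; apply: eq_bigr => a _; rewrite mulrA.
Qed.

Lemma continuous_iter M (L : series M R -> series M R) k :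
  continuous L -> continuous (iter k L).
Proof.
move=> Lc; elim: k => [|k IHk]; first exact: continuous_id.
exact: continuous_comp IHk Lc.
Qed.

End Continuity.

Section Multiplication.
Variable M : gradedMonoidType.

Lemma seriesM_kernel (R : pzRingType) (f g : series M R) v :
  (f * g) v = \sum_(a <- mball M (mdeg v)) f a * (mono a * g) v.
Proof.
rewrite seriesME [LHS]big_seq [RHS]big_seq; apply: eq_bigr => a.
rewrite mem_mball => le_a; rewrite -mulr_sumr; congr (_ * _); rewrite seriesME.
transitivity (\sum_(c <- mball M (mdeg v)) mono a c *
   \sum_(b <- mball M (mdeg v) | (c * b)%g == v) g b).
  by rewrite sum_mono.
by apply: eq_bigr => c _; rewrite mulr_sumr.
Qed.

Lemma continuous_mulr (R : pzRingType) (g : series M R) :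
  continuous (fun f => f * g).
Proof. by exists 0%N => f v; rewrite addn0 seriesM_kernel. Qed.

Variable R : comPzRingType.

Lemma continuous_mull (f : series M R) : continuous (fun g => f * g).
Proof.
exists 0%N => g v; rewrite addn0.
have kernelE (h : series M R) : (f * h) v = \sum_(b <- mball M (mdeg v))
    h b * \sum_(a <- mball M (mdeg v) | (a * b)%g == v) f a.
  rewrite seriesME; under eq_bigr do rewrite big_mkcond.
  rewrite exchange_big; apply: eq_bigr => b _ /=.
  by rewrite -big_mkcond mulr_sumr; apply: eq_bigr => a _; apply: mulrC.
rewrite kernelE [LHS]big_seq [RHS]big_seq; apply: eq_bigr => b.
by rewrite mem_mball => le_b; rewrite kernelE sum_mono.
Qed.

Lemma continuous_scale (k : R) : continuous (fun f : series M R => k *: f).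
Proof.
case: (continuous_id R M) => d idE; exists d => f v.
rewrite seriesZE {1}idE mulr_sumr; apply: eq_bigr => m _.
by rewrite seriesZE mulrCA.
Qed.

End Multiplication.

(** * Words and monomials *)

Section CommutativeSeries.
Variables (X : finType) (R : comPzRingType).

Fact cseriesMC : commutative (fun f g : series (cmon X) R => f * g).
Proof.
move=> f g; apply: seriesP => v; rewrite !seriesME.
under eq_bigr do rewrite big_mkcond.
rewrite exchange_big; apply: eq_bigr => a _ /=; rewrite [RHS]big_mkcond.
apply: eq_bigr => b _; rewrite mulrC; congr (if _ == v then _ else _).
by apply/ffunP => x; rewrite !ffunE addnC.
Qed.

HB.instance Definition _ :=
  GRing.PzRing_hasCommutativeMul.Build (series (cmon X) R) cseriesMC.

End CommutativeSeries.

Lemma pseries_mulC (c : varkind) (X : finType) (R : comPzRingType) :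
  c = Commutative -> commutative (fun f g : pseries c X R => f * g).
Proof. by move=> -> f g; apply: mulrC. Qed.

Section Words.
Variable c : varkind.

Definition mon (X : finType) (w : seq X) : monom c X :=
  foldr (fun x v => mvar c x * v)%g 1%g w.

Variable X : finType.
Implicit Types (w : seq X) (m : monom c X).

Lemma mdeg_mvar (x : X) : mdeg (mvar c x) = 1%N.
Proof.
case: c => //=; rewrite /mdeg /= /cdeg (bigD1 x) //= ffunE eqxx big1 // => y.
by rewrite ffunE => /negPf->.
Qed.

Lemma mdeg_mon w : mdeg (mon w) = size w.
Proof. by elim: w => [|x w IHw] /=; rewrite ?mdeg1 // mdegM mdeg_mvar IHw. Qed.

Lemma cmon_count w y :
  (foldr (fun x v => mvar Commutative x * v)%g 1%g w : cmon X) y = count_mem y w.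
Proof. by elim: w => [|x w IHw] /=; rewrite ffunE // -IHw ffunE eq_sym. Qed.

Lemma count_mword (m : cmon X) y :
  count_mem y (@mword Commutative X m) = m y.
Proof.
rewrite /mword count_flatten sumnE !big_map -enumT big_enum (bigD1 y) //=.
rewrite count_nseq /= eqxx mul1n big1 ?addn0 // => x /negPf ne_xy.
by rewrite count_nseq /= ne_xy.
Qed.

Lemma mon_mword m : mon (mword m) = m.
Proof.
rewrite /mon; case: c m => m; last by elim: m => //= x w ->.
by apply/ffunP => y; rewrite cmon_count count_mword.
Qed.

Lemma size_mword m : size (mword m) = mdeg m.
Proof. by rewrite -mdeg_mon mon_mword. Qed.

(** Reading a word back from its monomial returns the word itself in the
noncommutative case and only a permutation of it in the commutative case,
where the extra hypothesis makes P insensitive to permutations. *)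
Lemma mword_mon_inv T (P : seq X -> T) w :
    (c = Commutative ->
      forall w1 w2 w3, P (w1 ++ w2 ++ w3) = P (w2 ++ w1 ++ w3)) ->
  P (mword (mon w)) = P w.
Proof.
rewrite /mon; case: c => [/(_ erefl) PC|_]; last first.
  by congr (P _); elim: w => //= x w ->.
have: perm_eq w (@mword Commutative X (foldr (fun x v => mvar Commutative x * v)%g 1%g w)).
  by apply/allP => y _ /=; rewrite count_mword cmon_count.
move: (mword _) => w' ww'.
pose Q w'' := P w'' = P w; suff: Q w' by [].
by move: ww' (erefl : Q w); apply: catCA_perm_ind => w1 w2 w3; rewrite /Q PC.
Qed.

Variable R : comPzRingType.

Lemma prod_mword_mon Y (F : X -> pseries c Y R) w :
  \prod_(x <- mword (mon w)) F x = \prod_(x <- w) F x.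
Proof.
apply: (mword_mon_inv (P := fun w => \prod_(x <- w) F x)).
case: c F => // F _ w1 w2 w3; rewrite !big_cat /= mulrCA //.
Qed.

Lemma prod_zvar w : \prod_(x <- w) zvar x = mono (mon w) :> pseries c X R.
Proof. by elim: w => [|x w IHw]; rewrite ?big_nil // big_cons IHw monoM. Qed.

Lemma order_zvar x : order_ge 1 (zvar x : pseries c X R).
Proof.
by move=> v; rewrite /zvar; case: eqP => // ->; rewrite mdeg_mvar.
Qed.

(** Words are better suited than monomials to check an identity of operators:
they allow an induction that is uniform in c. *)
Lemma eq_continuous_words (M : gradedMonoidType)
    (L L' : pseries c X R -> series M R) :
  continuous L -> continuous L' ->
  (forall w : seq X, L (\prod_(x <- w) zvar x) = L' (\prod_(x <- w) zvar x)) ->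
  L =1 L'.
Proof.
move=> Lc L'c eqL; apply: eq_continuous => // m.
by rewrite -(mon_mword m) -prod_zvar.
Qed.

End Words.

(** * Substitutions are morphisms, and [u d/dz] is a derivation *)

Section Substitution.
Variables (c : varkind) (R : comPzRingType) (X Y : finType).
Variable F : X -> pseries c Y R.
Hypothesis F1 : forall x, order_ge 1 (F x).

Lemma subst_kernel : continuous (subst F) /\
  forall m, subst F (mono m) = \prod_(x <- mword m) F x.
Proof.
apply: (@continuous_kernel _ _ _ _ 0) => [m v|f v]; rewrite addn0 //.
by move=> lt_v; apply: (order_ge_prod F1); rewrite size_mword.
Qed.

Lemma continuous_subst : continuous (subst F).
Proof. by case: subst_kernel. Qed.

Lemma subst_word (w : seq X) :
  subst F (\prod_(x <- w) zvar x) = \prod_(x <- w) F x.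
Proof. by case: subst_kernel => _ E; rewrite prod_zvar E prod_mword_mon. Qed.

Lemma subst_zvar x : subst F (zvar x) = F x.
Proof. by have := subst_word [:: x]; rewrite !big_seq1. Qed.

Lemma subst1 : subst F 1 = 1.
Proof. by have := subst_word [::]; rewrite !big_nil. Qed.

(** Both sides are continuous in f and in g separately, so that f and g may be
taken to be words, where the identity is the concatenation of products. *)
Lemma substM f g : subst F (f * g) = subst F f * subst F g.
Proof.
have Fc := continuous_subst; move: f g.
suff E (w : seq X) g : subst F (\prod_(x <- w) zvar x * g) =
    subst F (\prod_(x <- w) zvar x) * subst F g.
  move=> f g; move: f; apply: eq_continuous_words => [||w]; last exact: E.
    exact: (continuous_comp (continuous_mulr g) Fc).
  exact: (continuous_comp Fc (continuous_mulr (subst F g))).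
move: g; apply: eq_continuous_words => [||w'].
- exact: (continuous_comp (continuous_mull _) Fc).
- exact: (continuous_comp Fc (continuous_mull _)).
by rewrite -big_cat !subst_word big_cat.
Qed.

End Substitution.

Section Derivations.
Variables (c : varkind) (R : comPzRingType) (X : finType).
Variable u : X -> pseries c X R.

Lemma order_zderiv_word w : order_ge (size w).-1 (zderiv_word u w).
Proof.
elim: w => [|x w IHw] /=; first by move=> v.
apply: order_geD.
  rewrite -[size w]add0n; apply: order_ge_mul => //.
  by apply: order_ge_prod => y; apply: order_zvar.
apply: order_geW (order_ge_mul (order_zvar _ x) IHw).
by case: (size w).
Qed.

Lemma zderiv_word_cat w1 w2 : zderiv_word u (w1 ++ w2) =
  zderiv_word u w1 * \prod_(x <- w2) zvar x +
  \prod_(x <- w1) zvar x * zderiv_word u w2.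
Proof.
elim: w1 => [|x w1 IHw] /=; first by rewrite big_nil mul0r mul1r add0r.
rewrite IHw !big_cat big_cons /= mulrDl mulrDr !mulrA -addrA //.
Qed.

Lemma zderiv_kernel : continuous (zderiv u) /\
  forall m, zderiv u (mono m) = zderiv_word u (mword m).
Proof.
apply: (@continuous_kernel _ _ _ _ 1) => [m v|f v]; rewrite addn1 //.
by move=> lt_m; apply: order_zderiv_word; rewrite size_mword -ltnS (ltn_predK lt_m).
Qed.

Lemma continuous_zderiv : continuous (zderiv u).
Proof. by case: zderiv_kernel. Qed.

(** The operator is defined through one particular word of each monomial; any
other word gives the same value, since in the commutative case Leibniz's rule
is symmetric. *)
Lemma zderiv_prod (w : seq X) :
  zderiv u (\prod_(x <- w) zvar x) = zderiv_word u w.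
Proof.
case: zderiv_kernel => _ E; rewrite prod_zvar E.
apply: (mword_mon_inv (P := zderiv_word u)).
move=> /(@pseries_mulC c X R) mulC w1 w2 w3.
rewrite !catA ![_ (_ ++ w3)]zderiv_word_cat !zderiv_word_cat !big_cat /=.
congr (_ * _ + _ * _); last exact: mulC.
by rewrite addrC; congr (_ + _); apply: mulC.
Qed.

Lemma zderiv_zvar x : zderiv u (zvar x) = u x.
Proof.
by have := zderiv_prod [:: x]; rewrite /= big_seq1 big_nil mulr1 mulr0 addr0.
Qed.

Lemma zderiv1 : zderiv u 1 = 0.
Proof. by have := zderiv_prod [::]; rewrite big_nil. Qed.

(** As for substitutions, continuity in each factor reduces Leibniz's rule to
words. *)
Lemma zderivM f g : zderiv u (f * g) = zderiv u f * g + f * zderiv u g.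
Proof.
have Dc := continuous_zderiv; move: f g.
suff E (w : seq X) g : zderiv u (\prod_(x <- w) zvar x * g) =
    zderiv u (\prod_(x <- w) zvar x) * g + \prod_(x <- w) zvar x * zderiv u g.
  move=> f g; move: f; apply: eq_continuous_words => [||w]; last exact: E.
    exact: (continuous_comp (continuous_mulr g) Dc).
  apply: continuous_add; last exact: continuous_mulr.
  exact: (continuous_comp Dc (continuous_mulr g)).
move: g; apply: eq_continuous_words => [||w'].
- exact: (continuous_comp (continuous_mull _) Dc).
- apply: continuous_add; first exact: continuous_mull.
  exact: (continuous_comp Dc (continuous_mull _)).
by rewrite -big_cat !zderiv_prod zderiv_word_cat.
Qed.

End Derivations.

(** * The operators [H(w) d/dz]^k / k! at w = z *)

Section Mixed.
Variables (A : pzRingType) (X : Type).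

(** The coefficient of s^k in the product over x in w of z x + s h x, for s a
central variable: the common value of all the forms of the k-th Taylor
operator at the word w. *)
Fixpoint mixed (z h : X -> A) (w : seq X) (k : nat) : A :=
  if w is x :: w' then
    z x * mixed z h w' k + (if k is k'.+1 then h x * mixed z h w' k' else 0)
  else (k == 0%N)%:R.

Lemma mixed0 (z h : X -> A) w : mixed z h w 0 = \prod_(x <- w) z x.
Proof.
by elim: w => [|x w IHw]; rewrite ?big_nil // big_cons /= addr0 IHw.
Qed.

Lemma eq_mixed (z z' h h' : X -> A) :
  z =1 z' -> h =1 h' -> mixed z h =2 mixed z' h'.
Proof.
move=> eqz eqh w k; elim: w k => //= x w IHw k.
by rewrite eqz eqh IHw; case: k => // k; rewrite IHw.
Qed.

End Mixed.

Lemma subst_mixed (c : varkind) (R : comPzRingType) (X Y : finType)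
    (F : X -> pseries c Y R) (Z : Type) (z h : Z -> pseries c X R) w k :
    (forall x, order_ge 1 (F x)) ->
  subst F (mixed z h w k) = mixed (subst F \o z) (subst F \o h) w k.
Proof.
move=> F1; have Fc := continuous_subst F1; elim: w k => [|x w IHw] k /=.
  by case: eqP => _; rewrite ?(subst1 F1) ?(continuous0 Fc).
rewrite (continuousD _ _ Fc) (substM F1) IHw.
by case: k => [|k]; rewrite ?(continuous0 Fc) // (substM F1) IHw.
Qed.

Section Lambda.
Variables (c : varkind) (K : comAlgType rat) (n : nat).
Variable H : 'I_n -> pseries c 'I_n K.

Local Notation D := (zw_derivation H).
Local Notation toz := (subst (fun j => zvar (inl j) : pseries c ('I_n + 'I_n)%type K)).
Local Notation tow := (subst (fun j => zvar (inr j) : pseries c ('I_n + 'I_n)%type K)).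
Local Notation diag := (subst (fun x : 'I_n + 'I_n =>
  match x with inl i => zvar i | inr i => zvar i end : pseries c 'I_n K)).

Let toz1 (j : 'I_n) : order_ge 1 (zvar (inl j) : pseries c ('I_n + 'I_n)%type K).
Proof. exact: order_zvar. Qed.
Let tow1 (j : 'I_n) : order_ge 1 (zvar (inr j) : pseries c ('I_n + 'I_n)%type K).
Proof. exact: order_zvar. Qed.
Let diag1 (x : 'I_n + 'I_n) : order_ge 1
  (match x with inl i => zvar i | inr i => zvar i end : pseries c 'I_n K).
Proof. by case: x => i; apply: order_zvar. Qed.

Let continuous_D : continuous D.
Proof. exact: continuous_zderiv. Qed.
Let DM f g : D (f * g) = D f * g + f * D g.
Proof. exact: zderivM. Qed.
Let D1 : D 1 = 0.
Proof. exact: zderiv1. Qed.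
Let D_z i : D (zvar (inl i)) = tow (H i).
Proof. exact: zderiv_zvar. Qed.
Let D_w i : D (zvar (inr i)) = 0.
Proof. exact: zderiv_zvar. Qed.

Lemma zw_derivation_w f : D (tow f) = 0.
Proof.
move: f; apply: eq_continuous_words => [||w].
- exact: continuous_comp (continuous_subst tow1) continuous_D.
- exact: continuous_zero.
rewrite (subst_word tow1); elim: w => [|x w IHw]; first by rewrite big_nil D1.
by rewrite big_cons DM D_w mul0r add0r IHw mulr0.
Qed.

Lemma diag_w f : diag (tow f) = f.
Proof.
move: f; apply: eq_continuous_words => [||w].
- exact: continuous_comp (continuous_subst tow1) (continuous_subst diag1).
- exact: continuous_id.
rewrite (subst_word tow1).
rewrite -(big_map inr xpredT (fun x => zvar x)) (subst_word diag1).
by rewrite big_map.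
Qed.

Local Notation E := (mixed (fun x : 'I_n => zvar (inl x)) (fun x => tow (H x))).

(** D replaces one more letter z_x by H_x and leaves those already replaced
alone; a choice of k + 1 letters arises from k + 1 choices of k letters. *)
Lemma zw_derivation_mixed (w : seq 'I_n) k :
  D (E w k) = k.+1%:R *: E w k.+1.
Proof.
elim: w k => [|x w IHw] k /=.
  by rewrite scaler0; case: eqP => _; rewrite ?D1 ?(continuous0 continuous_D).
rewrite (continuousD _ _ continuous_D) DM D_z IHw.
case: k => [|k]; first by rewrite (continuous0 continuous_D) addr0 !scale1r addrC.
rewrite DM zw_derivation_w mul0r add0r IHw.
rewrite !(continuousZ _ _ (continuous_mull _)) scalerDr addrAC addrC; congr (_ + _).
by rewrite -[k.+2]add1n natrD scalerDl scale1r.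
Qed.

Lemma zw_derivation_iter (w : seq 'I_n) k :
  iter k D (\prod_(x <- w) zvar (inl x)) = k`!%:R *: E w k.
Proof.
elim: k => [|k IHk]; first by rewrite /= mixed0 scale1r.
rewrite iterS IHk (continuousZ _ _ continuous_D) zw_derivation_mixed scalerA.
by rewrite factS mulnC natrM.
Qed.

Lemma lambda_word (w : seq 'I_n) k :
  lambda H k (\prod_(x <- w) zvar x) = mixed zvar H w k.
Proof.
rewrite /lambda (subst_word toz1) zw_derivation_iter.
rewrite (continuousZ _ _ (continuous_subst diag1)) scalerA.
have -> : (k`!%:R^-1 : rat)%:A * k`!%:R = 1 :> K.
  rewrite mulr_algl -scaler_nat scalerA mulVf ?scale1r //.
  by rewrite Num.Theory.pnatr_eq0 -lt0n fact_gt0.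
rewrite scale1r (subst_mixed _ _ _ _ diag1); apply: eq_mixed => x /=.
  by rewrite (subst_zvar diag1).
exact: diag_w.
Qed.

Lemma continuous_lambda k : continuous (lambda H k).
Proof.
have := continuous_comp (continuous_comp (continuous_subst toz1)
  (continuous_iter k continuous_D)) (continuous_subst diag1).
by move/continuous_comp; apply; apply: continuous_scale.
Qed.
End Lambda.

(** * The operators H^I / I! d^k/dz^I in commutative variables *)

Section Partial.
Variables (c : varkind) (R : comPzRingType) (X : finType).
Implicit Types (f : pseries c X R) (I : X -> nat) (s : seq X).

Lemma continuous_partial j : continuous (@partial c R X j).
Proof. exact: continuous_zderiv. Qed.

(** [partialI] along an arbitrary list of variables, which is what an induction
over the enumeration of the variables requires. *)
Definition partials s I f := foldr (fun j => iter (I j) (partial j)) f s.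

Lemma continuous_partials s I : continuous (partials s I).
Proof.
elim: s => [|j s IHs]; first exact: continuous_id.
exact: continuous_comp IHs (continuous_iter _ (continuous_partial j)).
Qed.

Lemma iter_partial_zvarM j x i f :
  iter i (partial j) (zvar x * f) =
  zvar x * iter i (partial j) f + iter i.-1 (partial j) f *+ ((x == j) * i).
Proof.
elim: i => [|i IHi] /=; first by rewrite muln0 mulr0n addr0.
rewrite IHi (continuousD _ _ (continuous_partial j)).
rewrite (continuousMn _ _ (continuous_partial j)) /partial zderivM zderiv_zvar.
rewrite -!/(partial _) addrAC addrC; congr (_ + _).
case: (x == j) => /=; first last.
  by rewrite !mul0n !mulr0n mul0r addr0.
rewrite mul1r !mul1n mulrS; congr (_ + _).
by case: i {IHi}.
Qed.

(** Leibniz's rule for the product with a variable: its second derivatives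
vanish, so at most one of the I x derivatives in direction x acts on it. *)
Lemma partials_zvarM s I x f : uniq s ->
  partials s I (zvar x * f) = zvar x * partials s I f +
    partials s (fun j => I j - (j == x))%N f *+ ((x \in s) * I x).
Proof.
elim: s => [|j s IHs] /=; first by rewrite mulr0n addr0.
case/andP=> s'j s_uniq; have Dc := continuous_iter (I j) (continuous_partial j).
rewrite IHs // (continuousD _ _ Dc) (continuousMn _ _ Dc) iter_partial_zvarM.
rewrite -addrA; congr (_ + _); rewrite in_cons eq_sym.
case: (eqVneq j x) => [<-|ne_jx] /=; last first.
  by rewrite subn0 mul0n mulr0n add0r.
rewrite (negPf s'j) mul0n mulr0n addr0 subn1; congr (iter _ _ _ *+ _).
rewrite /partials; elim: s s'j {IHs s_uniq} => //= k s IHs.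
rewrite in_cons negb_or => /andP[ne_jk /IHs ->].
by rewrite eq_sym (negPf ne_jk) subn0.
Qed.

Lemma partials1 s I : partials s I 1 = (all (fun j => I j == 0)%N s)%:R.
Proof.
elim: s => //= j s ->; case: (I j) => //= i.
elim: i => [|i IHi] /=; last by rewrite IHi (continuous0 (continuous_partial j)).
by case: (all _ _); [apply: zderiv1 | apply: (continuous0 (continuous_partial j))].
Qed.

End Partial.

Section LambdaComm.
Variables (K : comAlgType rat) (n : nat).
Variable H : 'I_n -> pseries Commutative 'I_n K.
Implicit Types (I J : cmon 'I_n).

Definition taylor_term I (f : pseries Commutative 'I_n K) :
    pseries Commutative 'I_n K :=
  ((\prod_j (I j)`!)%N%:R^-1 : rat)%:A *:
    (\prod_j H j ^+ I j * partialI I f).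

Lemma lambda_commE k f :
  lambda_comm H k f = \sum_(I <- clevel 'I_n k) taylor_term I f.
Proof.
rewrite big_map big_filter big_enum_cond; apply: eq_bigr => I _.
set J := (J in taylor_term J f); have JE j : J j = I j by rewrite ffunE.
rewrite /taylor_term -(eq_bigr _ (fun j _ => congr1 factorial (JE j))).
rewrite -(eq_bigr _ (fun j _ => congr1 (fun i => H j ^+ i) (JE j))).
by rewrite (_ : (fun j => I j : nat) = J) //; apply: funext => j; rewrite JE.
Qed.

Lemma continuous_lambda_comm k : continuous (lambda_comm H k).
Proof.
apply: continuous_bigsum => I.
have Pc := @continuous_partials Commutative K _ (enum 'I_n) (fun j => I j : nat).
have := continuous_comp Pc (continuous_mull (\prod_j H j ^+ I j)).
by move/continuous_comp; apply; apply: continuous_scale.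
Qed.

Lemma lambda_comm1 k : lambda_comm H k 1 = (k == 0%N)%:R.
Proof.
rewrite lambda_commE.
transitivity (\sum_(I <- clevel 'I_n k | I == 1%g) (1 : pseries Commutative 'I_n K)).
  rewrite [RHS]big_mkcond; apply: eq_bigr => I _; rewrite /taylor_term.
  rewrite -[partialI I]/(partials (enum 'I_n) I) partials1.
  case: eqP => [->|I_neq1].
    under eq_bigr do rewrite ffunE; rewrite big1 // invr1 scale1r scale1r.
    rewrite big1 => [|j _]; last by rewrite ffunE.
    by rewrite mul1r; case: allP => // -[j _]; rewrite ffunE.
  case: allP => [I0|]; last by rewrite mulr0 scaler0.
  by case: I_neq1; apply/ffunP => j; rewrite ffunE (eqP (I0 j _)) ?mem_enum.
have [->|k_neq0] := eqVneq k 0%N.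
  by rewrite (sum_pred1 (fun=> _)) ?clevel_uniq // mem_clevel cmon_deg1.
rewrite big_seq_cond big1 // => I /andP[/[swap]/eqP->].
by rewrite mem_clevel cmon_deg1 eq_sym (negPf k_neq0).
Qed.

(** The multi-indices of weight k + 1 with a positive entry at x are the J + e_x
with J of weight k. *)
Lemma sum_clevelS (x : 'I_n) k (B : cmon 'I_n -> pseries Commutative 'I_n K) :
    (forall I, I x = 0%N -> B I = 0) ->
  \sum_(I <- clevel 'I_n k.+1) B I =
  \sum_(I <- clevel 'I_n k) B (mvar Commutative x * I)%g.
Proof.
move=> B0; rewrite (bigID (fun I : cmon 'I_n => 0 < I x)%N) /= addrC big1 => [|I].
  rewrite add0r -big_filter -[RHS](big_map (fun I => mvar Commutative x * I)%g xpredT).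
  apply/perm_big/uniq_perm; first exact/filter_uniq/clevel_uniq.
    rewrite map_inj_uniq ?clevel_uniq // => I J /ffunP E.
    by apply/ffunP => y; have := E y; rewrite !ffunE => /addnI.
  move=> I; rewrite mem_filter mem_clevel; apply/andP/mapP => [[Ix /eqP dI]|[J]].
    pose J : cmon 'I_n := [ffun y => I y - (y == x)]%N.
    have IJ : I = (mvar Commutative x * J)%g.
      apply/ffunP => y; rewrite !ffunE; case: eqP => [->|_]; last by rewrite subn0.
      by rewrite subnKC.
    exists J => //; move/eqP: dI.
    by rewrite IJ mem_clevel cmon_degM [cdeg _](mdeg_mvar Commutative x).
  rewrite mem_clevel => /eqP dJ ->.
  by rewrite cmon_degM [cdeg _](mdeg_mvar Commutative x) dJ !ffunE eqxx.
by rewrite -eqn0Ngt => /eqP; apply: B0.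
Qed.

Lemma taylor_term_zvarM (x : 'I_n) I f :
  taylor_term I (zvar x * f) = zvar x * taylor_term I f +
   ((\prod_j (I j)`!)%N%:R^-1 : rat)%:A *:
    (\prod_j H j ^+ I j * (partialI (fun j => I j - (j == x))%N f *+ I x)).
Proof.
rewrite /taylor_term -[partialI I]/(partials (enum 'I_n) I) partials_zvarM ?enum_uniq //.
rewrite mem_enum mul1n mulrDr scalerDr; congr (_ + _).
by rewrite (continuousZ _ _ (continuous_mull _)) mulrCA.
Qed.

(** The recursion in the word that defines [mixed].  The second term of
Leibniz's rule, with I = J + e_x, carries the factor I x that turns 1/I! into
1/J!, and leaves one factor H x in front. *)
Lemma lambda_comm_zvarM (x : 'I_n) k f :
  lambda_comm H k (zvar x * f) = zvar x * lambda_comm H k f +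
    (if k is k'.+1 then H x * lambda_comm H k' f else 0).
Proof.
rewrite !lambda_commE; under eq_bigr do rewrite taylor_term_zvarM.
rewrite big_split -mulr_sumr; congr (_ + _); case: k => [|k] /=.
  rewrite big_seq big1 // => I; rewrite mem_clevel /cdeg sum_nat_eq0 => /forallP.
  by move=> /(_ x)/eqP ->; rewrite mulr0n mulr0 scaler0.
rewrite (@sum_clevelS x) => [|I ->]; last by rewrite mulr0n mulr0 scaler0.
rewrite lambda_commE mulr_sumr; apply: eq_bigr => I _; rewrite /taylor_term.
rewrite (continuousZ _ _ (continuous_mull _)) mulrA.
have -> : \prod_j H j ^+ (mvar Commutative x * I)%g j =
    H x * \prod_j H j ^+ I j.
  rewrite (bigD1 x) //= [in RHS](bigD1 x) //= !ffunE eqxx exprS -mulrA.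
  by congr (_ * (_ * _)); apply: eq_bigr => j /negPf ne_jx; rewrite !ffunE ne_jx.
have -> : (\prod_j ((mvar Commutative x * I)%g j)`! = (I x).+1 * \prod_j (I j)`!)%N.
  rewrite (bigD1 x) //= [in RHS](bigD1 x) //= !ffunE eqxx factS -mulnA.
  by congr (_ * (_ * _))%N; apply: eq_bigr => j /negPf ne_jx; rewrite !ffunE ne_jx.
have -> : partialI (fun j => (mvar Commutative x * I)%g j - (j == x))%N f = partialI I f.
  by congr partialI; apply: funext => j; rewrite !ffunE addKn.
rewrite !ffunE eqxx add1n mulrnAr -scaler_nat scalerA; congr (GRing.scale _ _).
rewrite mulr_algl -scaler_nat scalerA natrM invfM mulrAC mulVf ?mul1r //.
by rewrite Num.Theory.pnatr_eq0.
Qed.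

Lemma lambda_comm_word (w : seq 'I_n) k :
  lambda_comm H k (\prod_(x <- w) zvar x) = mixed zvar H w k.
Proof.
elim: w k => [|x w IHw] k; first by rewrite big_nil lambda_comm1.
by rewrite big_cons lambda_comm_zvarM IHw /=; case: k => // k; rewrite IHw.
Qed.

End LambdaComm.

(** * Taylor's formula for z - t H *)

Section Kernel.
Variables (c : varkind) (R : comPzRingType) (X : finType).
Variable H : X -> pseries c X R.
Hypothesis H1 : forall x, order_ge 1 (H x).

Lemma order_mixed w k : order_ge (size w) (mixed zvar H w k).
Proof.
elim: w k => [|x w IHw] k //=; apply: order_geD.
  exact: (order_ge_mul (order_zvar _ x) (IHw k)).
case: k => [|k]; first by move=> v.
exact: (order_ge_mul (H1 x) (IHw k)).
Qed.

(** The property shared by both expressions of the k-th Taylor operator, and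
the only one that the rest of the proof relies on. *)
Definition taylor_op (L : pseries c X R -> pseries c X R) k :=
  continuous L /\ forall w : seq X, L (\prod_(x <- w) zvar x) = mixed zvar H w k.

(** As H has no constant term, the value on a word of size d has order at least
d; hence the sum stops at the degree of v, just as in [subst]. *)
Lemma taylor_opE L k f v : taylor_op L k ->
  L f v = \sum_(m <- mball (monom c X) (mdeg v)) f m * mixed zvar H (mword m) k v.
Proof.
case=> /continuous_widen[d Ld] Lw; rewrite (Ld (mdeg v + d)%N) //.
rewrite (@sum_mball _ _ _ (mdeg v)) ?leq_addr // => [|m lt_m].
  by apply: eq_bigr => m _; rewrite -Lw prod_zvar mon_mword.
rewrite -[m]mon_mword -prod_zvar Lw order_mixed ?mulr0 //.
by rewrite size_mword.
Qed.

Lemma taylor_op0 L : taylor_op L 0 -> L =1 id.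
Proof.
case=> Lc Lw; apply: eq_continuous_words => // [|w]; first exact: continuous_id.
by rewrite Lw mixed0.
Qed.

End Kernel.

Section TCoefficients.
Variable K : comPzRingType.

Lemma tpowME (f g : series tpow K) (p : nat) :
  (f * g) p = \sum_(a < p.+1) f (a : nat) * g (p - a)%N.
Proof.
rewrite seriesME [mball _ _](flatten_seq1 (iota 0 p.+1)).
rewrite -(big_mkord xpredT (fun a : nat => f a * g (p - a)%N)) /index_iota subn0.
rewrite big_seq [RHS]big_seq; apply: eq_bigr => a.
rewrite mem_iota ltnS => /= le_ap.
rewrite (eq_bigl (fun b : tpow => b == (p - a)%N :> tpow)) => [|b].
  rewrite sum_pred1 //; first exact: (iota_uniq 0 p.+1).
  by rewrite (mem_iota 0 p.+1) ltnS leq_subr.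
by apply/eqP/eqP => [<-|->]; [exact/esym/addKn | exact: subnKC].
Qed.

Definition tcoef (M : gradedMonoidType) p (f : series M (series tpow K)) :
  series M K := fun v => f v p.

Variables (c : varkind) (X : finType).
Implicit Types (P : pseries c X (series tpow K)) (f : pseries c X K).

Lemma tcoef_consttM p f P : tcoef p (constt f * P) = f * tcoef p P.
Proof.
apply: seriesP => v; rewrite /tcoef !seriesME series_sumE; apply: eq_bigr => a _.
rewrite series_sumE; apply: eq_bigr => b _; rewrite /constt.
by rewrite (continuousZ _ _ (continuous_mulr (P b))) mul1r seriesZE.
Qed.

Lemma tcoef_tparamZ p P :
  tcoef p (tparam K *: P) = if p is q.+1 then tcoef q P else 0.
Proof.
apply: seriesP => v; rewrite /tcoef seriesZE tpowME /tparam.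
case: p => [|p]; first by rewrite big_ord_recl big_ord0 mul0r addr0.
rewrite !big_ord_recl /= mul0r add0r mul1r subn1 big1 ?addr0 // => a _.
by rewrite mul0r.
Qed.

Lemma constt_zvar x : constt (zvar x) = zvar x :> pseries c X (series tpow K).
Proof.
apply: seriesP => v; rewrite /constt /zvar.
by case: eqP => _; rewrite ?scale1r ?scale0r.
Qed.

Variables (H : X -> pseries c X K) (F : X -> pseries c X (series tpow K)).
Hypothesis H1 : forall x, order_ge 1 (H x).
Hypothesis FE : forall x, F x = zvar x - tparam K *: constt (H x).

Lemma tcoef_prod (w : seq X) p :
  tcoef p (\prod_(x <- w) F x) = (-1) ^+ p *: mixed zvar H w p.
Proof.
elim: w p => [|x w IHw] p.
  rewrite big_nil; apply: seriesP => v; rewrite /tcoef seriesZE /=.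
  case: p => [|p]; rewrite ?mul1r /= ?mulr0n ?mulr1n.
    by rewrite [LHS]/(((v == 1%g)%:R : series tpow K) 0%N) series1E; case: (v == 1%g).
  by rewrite series0E mulr0 series1E; case: (v == 1%g).
rewrite big_cons; set P := \prod_(y <- w) F y; rewrite FE mulrBl -scaleN1r.
have -> : tcoef p (zvar x * P + -1 *: (tparam K *: constt (H x) * P)) =
    tcoef p (zvar x * P) - tcoef p (tparam K *: (constt (H x) * P)).
  rewrite scaleN1r (continuousZ _ _ (continuous_mulr P)).
  by apply: seriesP.
rewrite -constt_zvar tcoef_consttM tcoef_tparamZ IHw.
rewrite (continuousZ _ _ (continuous_mull _)) /= scalerDr; congr (_ + _).
case: p => [|p]; first by rewrite scaler0 oppr0.
rewrite tcoef_consttM IHw (continuousZ _ _ (continuous_mull _)).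
by rewrite exprS mulN1r scaleNr.
Qed.

(** Taylor's formula: since P = sum_a t^a P_a with each P_a over K, the
coefficient of t^p in P(z - t H) collects those of t^(p - a) in the
P_a(z - t H). *)
Lemma tcoef_subst (L : nat -> pseries c X K -> pseries c X K) P p :
    (forall k, taylor_op H (L k) k) ->
  tcoef p (subst F P) =
    \sum_(a < p.+1) (-1) ^+ (p - a) *: L (p - a)%N (tcoef a P).
Proof.
move=> LT; apply: seriesP => v; rewrite /tcoef /subst !series_sumE.
under eq_bigr do rewrite tpowME.
rewrite exchange_big; apply: eq_bigr => a _ /=.
rewrite seriesZE (taylor_opE H1 _ _ (LT _)) mulr_sumr; apply: eq_bigr => m _.
by rewrite mulrCA -seriesZE -tcoef_prod.
Qed.

End TCoefficients.

(** * Solving the recursion *)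

Section Compositions.

(** With the empty composition of 0, which starts the recursion. *)
Definition compositions0 m := if m is 0 then [:: [::]] else compositions m.

Lemma mem_compositions0 m I :
  (I \in compositions0 m) = all (leq 1) I && (sumn I == m).
Proof.
case: m => [|m]; last by rewrite mem_compositions; case: I.
by rewrite inE; case: I => //= -[|i] I //=; rewrite andbF.
Qed.

Lemma compositions0_uniq m : uniq (compositions0 m).
Proof. by case: m => // m; apply: compositions_uniq. Qed.

(** A composition of m is a first part m - a followed by a composition of a,
the latter being empty when a = 0. *)
Lemma sum_compositions (V : zmodType) (B : seq nat -> V) m : (0 < m)%N ->
  \sum_(I <- compositions m) B I =
  \sum_(a < m) \sum_(I <- compositions0 a) B ((m - a)%N :: I).
Proof.
move=> m_gt0; rewrite -(big_mkord xpredT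
  (fun a => \sum_(I <- compositions0 a) B ((m - a)%N :: I))).
rewrite -(big_allpairs_dep (h := fun a I => (m - a)%N :: I)).
apply/perm_big/uniq_perm; first exact: compositions_uniq.
  apply: allpairs_uniq_dep => [||[a I] [b J]]; first exact: iota_uniq.
    by move=> a _; apply: compositions0_uniq.
  move=> /allpairsPdep[a' [I' [_ + [-> ->]]]] /allpairsPdep[b' [J' [_ + [-> ->]]]].
  rewrite !mem_compositions0 => /andP[_ /eqP sI] /andP[_ /eqP sJ] [_ IJ].
  by rewrite -sI -sJ IJ.
move=> I; rewrite mem_compositions; apply/and3P/allpairsPdep => [[]|].
  case: I => // i I _ /= /andP[i_gt0 I_gt0] /eqP sI; exists (sumn I), I.
  split; first by rewrite mem_index_iota -sI -[ltnLHS]add0n ltn_add2r.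
    by rewrite mem_compositions0 I_gt0 eqxx.
  by rewrite -sI addnK.
case=> a [J [+ + ->]]; rewrite mem_index_iota mem_compositions0 /=.
move=> lt_am /andP[J_gt0 /eqP sJ]; rewrite sJ subn_gt0 lt_am J_gt0.
by rewrite subnK // ltnW.
Qed.

Variables (R : comPzRingType) (M : gradedMonoidType).
Variables (L : nat -> series M R -> series M R) (N : nat -> series M R).
Hypothesis L_cont : forall k, continuous (L k).
Hypothesis L0 : L 0%N =1 id.
Hypothesis N_rec : forall p, (0 < p)%N ->
  \sum_(a < p.+1) (-1) ^+ (p - a) *: L (p - a)%N (N a) = 0.

Lemma sum_over_compositions m : N m = (-1) ^+ m *:
  \sum_(I <- compositions0 m) (-1) ^+ size I *: op_comp L I (N 0).
Proof.
elim/ltn_ind: m => -[_|m IHm]; first by rewrite big_seq1 !scale1r.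
have := N_rec (ltn0Sn m); rewrite big_ord_recr /= subnn scale1r L0.
move/eqP; rewrite addrC addr_eq0 => /eqP ->.
rewrite sum_compositions // scaler_sumr -sumrN; apply: eq_bigr => a _.
rewrite [in LHS]IHm // (continuousZ _ _ (L_cont _)) scalerA -exprD.
rewrite subnK ?(ltnW (ltn_ord a)) // -scalerN; congr (_ *: _).
rewrite (continuous_sum _ _ _ (L_cont _)) -sumrN; apply: eq_bigr => I _.
by rewrite (continuousZ _ _ (L_cont _)) /= exprS mulN1r scaleNr.
Qed.

End Compositions.

(** * The inversion formula *)

Theorem proposition5p5 (K : comAlgType rat) (c : varkind) (n alpha : nat)
    (H : 'I_n -> pseries c 'I_n K)
    (F G : 'I_n -> pseries c 'I_n (series tpow K))
    (N : nat -> 'I_n -> pseries c 'I_n K)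
    (alpha_ge1 : (1 <= alpha)%N)
    (F_Et : in_Et alpha H F)
    (FG_inv : inverse_map F G)
    (* N m is N_[m], used for m >= 1 only *)
    (G_N : forall i, G i = zvar i + tparam K *: tsum (fun j => N j.+1 i))
    (m : nat) (m_ge1 : (1 <= m)%N) :
  (forall i, N m i = (-1) ^+ m *:
     \sum_(I <- compositions m) (-1) ^+ size I *: op_comp (lambda H) I (zvar i))
  /\
  (c = Commutative -> forall i, N m i = (-1) ^+ m *:
     \sum_(I <- compositions m)
        (-1) ^+ size I *: op_comp (lambda_comm H) I (zvar i)).
Proof.
have [Halpha FE _] := F_Et; have [_ _ FG] := FG_inv.
have H1 i : order_ge 1 (H i) by apply: order_geW (Halpha i).
have zvar_coef p i : tcoef p (zvar i) =
    if p is 0 then zvar i else 0 :> pseries c 'I_n K.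
  case: p => [|p]; apply: seriesP => v; rewrite /tcoef /zvar;
    by case: (v == mvar c i).
have G_coef p i : tcoef p (G i) = if p is 0 then zvar i else N p i.
  rewrite G_N; have -> P Q : tcoef p (P + Q) = tcoef p P + tcoef p Q by [].
  rewrite zvar_coef tcoef_tparamZ.
  by case: p => [|p]; rewrite ?addr0 // add0r; apply: seriesP.
suff main L : (forall k, taylor_op H (L k) k) -> forall i, N m i =
    (-1) ^+ m *: \sum_(I <- compositions m) (-1) ^+ size I *: op_comp L I (zvar i).
  split=> [|c_comm].
    by apply: main => k; split=> [|w]; [apply: continuous_lambda | rewrite lambda_word].
  apply: main => k; subst c.
  by split=> [|w]; [apply: continuous_lambda_comm | rewrite lambda_comm_word].
move=> LT i; have Lc k : continuous (L k) by case: (LT k).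
have := @sum_over_compositions K _ L (fun p => tcoef p (G i)) Lc.
move/(_ (taylor_op0 (LT 0%N)))/(_ _ m); rewrite !G_coef; case: m m_ge1 => // m' _.
apply=> p p_gt0; rewrite -(tcoef_subst H1 FE) // FG zvar_coef.
by case: p p_gt0.
Qed.
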